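(* Let $V$ be a real vector space, let $F$ be a square root closed, semiprime $f$-algebra, let $T\colon V\times V\to F$ be a vector semi-inner product, and let $u\in F^+$. Define $\|x\|^T_u:=T(x,x)\boxtimes u$ for $x\in V$. Then for all $x,y\in V$, \[ \|x+y\|^T_u\le\sqrt{(\|x\|^T_u+\|y\|^T_u)^2-\inf_{\lambda\in\mathbb{R}\setminus\{0\}}\{|\lambda|^{-1}(\|\lambda x-y\|^T_u)^2\}}\le \|x\|^T_u+\|y\|^T_u \] (where the infimum exists in $F$). Moreover, the equality \[ \|x+y\|^T_u=\sqrt{(\|x\|^T_u+\|y\|^T_u)^2-\inf_{\lambda\in\mathbb{R}\setminus\{0\}}\{|\lambda|^{-1}(\|\lambda x-y\|^T_u)^2\}} \] holds if and only if $T(x,y)u\in F^+$.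
   Context: All vector spaces are over $\mathbb{R}$ and all vector lattices are Archimedean; $F^+=\{x\in F:x\ge0\}$. An $f$-algebra is a vector lattice $F$ with an associative bilinear multiplication (written by juxtaposition) such that $xy\in F^+$ for $x,y\in F^+$, and $\inf\{x,y\}=0$ implies $\inf\{xz,y\}=\inf\{x,yz\}=0$ for all $z\in F^+$. It is semiprime if it has no nonzero nilpotent elements. A semiprime $f$-algebra is square root closed if for every $a\in F^+$ there is $b\in F^+$ with $b^2=a$; such $b$ is unique and is denoted $\sqrt{a}$. For $u,v\in F^+$, $u\boxtimes v:=2^{-1}\inf\{\theta u+\theta^{-1}v:\theta\in(0,\infty)\}$ (this infimum exists in the present setting). A map $T\colon V\times V\to F$ is a vector semi-inner product if it is bilinear, symmetric ($T(x,y)=T(y,x)$), and satisfies $T(x,x)\ge 0$ for all $x\in V$. *)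

(* Defs.v *)
From HB Require Import structures.
From mathcomp Require Import all_boot all_order all_algebra.
From mathcomp Require Import reals.
From Stdlib Require Import ClassicalEpsilon.
Set Implicit Arguments. Unset Strict Implicit. Unset Printing Implicit Defensive.
Import Order.TTheory GRing.Theory Num.Theory.
Local Open Scope ring_scope.

Section Defs.
Variables (R : realType) (F : lmodType R).
Variable le : F -> F -> Prop.
Variable mul : F -> F -> F.

Definition is_glb (S : F -> Prop) (a : F) : Prop :=
  (forall z, S z -> le a z) /\ (forall b, (forall z, S z -> le b z) -> le b a).
Definition is_lub (S : F -> Prop) (a : F) : Prop :=
  (forall z, S z -> le z a) /\ (forall b, (forall z, S z -> le z b) -> le a b).

Definition pair_set (x y : F) : F -> Prop := fun z => z = x \/ z = y.

Definition archimedean_vector_lattice : Prop :=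
  (forall x, le x x) /\
  (forall x y, le x y -> le y x -> x = y) /\
  (forall x y z, le x y -> le y z -> le x z) /\
  (forall x y z, le x y -> le (x + z) (y + z)) /\
  (forall (a : R) x y, 0 <= a -> le x y -> le (a *: x) (a *: y)) /\
  (forall x y, exists a, is_glb (pair_set x y) a) /\
  (forall x y, exists a, is_lub (pair_set x y) a) /\
  (forall x y, (forall n : nat, le (x *+ n) y) -> le x 0).

Definition f_algebra : Prop :=
  archimedean_vector_lattice /\
  (forall (a : R) x y z, mul (a *: x + y) z = a *: mul x z + mul y z) /\
  (forall (a : R) x y z, mul x (a *: y + z) = a *: mul x y + mul x z) /\
  (forall x y z, mul x (mul y z) = mul (mul x y) z) /\
  (forall x y, le 0 x -> le 0 y -> le 0 (mul x y)) /\
  (forall x y z, is_glb (pair_set x y) 0 -> le 0 z ->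
     is_glb (pair_set (mul x z) y) 0 /\ is_glb (pair_set x (mul y z)) 0).

(* x^(n+1) = iter n (mul x) x *)
Definition semiprime : Prop :=
  forall x : F, (exists n : nat, iter n (mul x) x = 0) -> x = 0.

Definition sqrt_closed : Prop :=
  forall a, le 0 a -> exists b, le 0 b /\ mul b b = a.

Definition glbF (S : F -> Prop) : F :=
  epsilon (inhabits 0) (fun a => is_glb S a).

(* the square root (meaningful for a >= 0 in a square root closed F) *)
Definition sqrtF (a : F) : F :=
  epsilon (inhabits 0) (fun b => le 0 b /\ mul b b = a).

Definition boxtimes (u v : F) : F :=
  2^-1 *: glbF (fun z => exists theta : R, 0 < theta /\ z = theta *: u + theta^-1 *: v).

Variable V : lmodType R.

Definition vector_semi_inner_product (T : V -> V -> F) : Prop :=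
  [/\ (forall (a : R) x y z, T (a *: x + y) z = a *: T x z + T y z),
      (forall x y, T x y = T y x) &
      (forall x, le 0 (T x x))].

Definition normTu (T : V -> V -> F) (u : F) (x : V) : F := boxtimes (T x x) u.

End Defs.

(* Main.v *)
(** Put [A = N x ^ 2], [B = N y ^ 2] and [C = T(x,y) u].  In a square root closed
    semiprime f-algebra [a ⊠ v] is the square root of [a v], so [N z ^ 2 = T(z,z) u]
    and the family under the infimum is [t A + t^-1 B - 2 C], [t A + t^-1 B + 2 C]
    for [t > 0].  Its infimum is [2 (N x) (N y) - 2 |C|], so the radicand is
    [A + B + 2 |C|], to be compared with [N (x + y) ^ 2 = A + B + 2 C].

    The algebraic input is obtained by localization: in an Archimedean vector
    lattice, every positive [w] not disjoint from [x >= 0] has a nonzero fragment on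
    which a given [y >= 0] is a scalar multiple of [x] up to [d x].  This makes
    positive orthomorphisms commute, hence, by semiprimeness, the multiplication
    commutative; and it bounds every lower bound of [t c^2 + t^-1 d^2] by [2 c d]. *)

Require Import Defs.
From mathcomp Require Import all_boot all_order all_algebra.
From mathcomp Require Import reals.
From mathcomp Require Import ring lra.
From Stdlib Require Import ClassicalEpsilon.
Import Order.TTheory GRing.Theory Num.Theory.
Local Open Scope ring_scope.

Set Implicit Arguments. Unset Strict Implicit. Unset Printing Implicit Defensive.

(** * Reflexive decision of identities in modules *)

Inductive mexp (R : Type) : Type :=
  | MVar of nat | MZero | MAdd of mexp R & mexp R | MOpp of mexp R
  | MScale of R & mexp R | MMuln of mexp R & nat.

Arguments MVar {R}. Arguments MZero {R}.

Section ModuleReflection.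
Variables (R : comNzRingType) (F : lmodType R).

Fixpoint meval (env : seq F) (e : mexp R) : F :=
  match e with
  | MVar k => nth 0 env k
  | MZero => 0
  | MAdd a b => meval env a + meval env b
  | MOpp a => - meval env a
  | MScale c a => c *: meval env a
  | MMuln a n => meval env a *+ n
  end.

Fixpoint mcoef (i : nat) (e : mexp R) : R :=
  match e with
  | MVar k => if Nat.eqb k i then 1 else 0
  | MZero => 0
  | MAdd a b => mcoef i a + mcoef i b
  | MOpp a => - mcoef i a
  | MScale c a => c * mcoef i a
  | MMuln a n => mcoef i a * n%:R
  end.

Fixpoint mcoef_eq (n : nat) (a b : mexp R) : Prop :=
  if n is n'.+1 then mcoef n' a = mcoef n' b /\ mcoef_eq n' a b else True.

Lemma meval_sum env e :
  meval env e = \sum_(i < size env) mcoef i e *: nth 0 env i.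
Proof.
elim: e => [k||a IHa b IHb|a IHa|c a IHa|a IHa n] /=.
- have E i : (if Nat.eqb k i then 1 else 0 : R) = (k == i)%:R.
    by case: (PeanoNat.Nat.eqb_spec k i) => [->|/eqP/negPf->]; rewrite ?eqxx.
  case: (ltnP k (size env)) => hk.
    rewrite (bigD1 (Ordinal hk)) //= E eqxx scale1r big1 ?addr0 // => i /eqP ne.
    rewrite E; case: eqP => [e|_]; last by rewrite scale0r.
    by case: ne; apply: val_inj.
  rewrite nth_default // big1 // => i _.
  by rewrite E; case: eqP hk => [->|_ _]; rewrite ?scale0r // leqNgt ltn_ord.
- by rewrite big1 // => i _; rewrite scale0r.
- by rewrite IHa IHb -big_split; apply: eq_bigr => i _; rewrite scalerDl.
- by rewrite IHa -sumrN; apply: eq_bigr => i _; rewrite scaleNr.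
- by rewrite IHa scaler_sumr; apply: eq_bigr => i _; rewrite scalerA.
- rewrite IHa -sumrMnl; apply: eq_bigr => i _.
  by rewrite mulr_natr scalerMnl.
Qed.

(** Comparing coefficients atom by atom turns a module identity into scalar identities, which [ring]
    or [field] can settle. *)
Lemma meval_eq env a b : mcoef_eq (size env) a b -> meval env a = meval env b.
Proof.
move=> h; rewrite !meval_sum; apply: eq_bigr => i _; congr (_ *: _).
elim: (size env) h i => [|n IH] /= => [_ [] //|[h0 h] i].
case: (ltngtP i n) (ltn_ord i) => [lt _|gt /(leq_trans gt)|-> _] //.
- exact: (IH h (Ordinal lt)).
- by rewrite ltnn.
Qed.

End ModuleReflection.

Ltac mindex x env :=
  lazymatch env with
  | cons ?y ?env' =>
    match constr:(Set) with
    | _ => let _ := match constr:(Set) with _ => unify x y end in constr:(O)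
    | _ => let k := mindex x env' in constr:(S k)
    end
  end.

Ltac madd T x env :=
  match constr:(Set) with
  | _ => let _ := mindex x env in env
  | _ => constr:(@cons T x env)
  end.

Ltac matoms T e env :=
  lazymatch e with
  | GRing.zero => env
  | @GRing.add _ ?a ?b => let env := matoms T a env in matoms T b env
  | @GRing.opp _ ?a => matoms T a env
  | @GRing.scale _ _ _ ?a => matoms T a env
  | @GRing.natmul _ ?a _ => matoms T a env
  | _ => madd T e env
  end.

Ltac mreify R e env :=
  lazymatch e with
  | GRing.zero => constr:(@MZero R)
  | @GRing.add _ ?a ?b =>
    let a := mreify R a env in let b := mreify R b env in constr:(@MAdd R a b)
  | @GRing.opp _ ?a => let a := mreify R a env in constr:(@MOpp R a)
  | @GRing.scale _ _ ?c ?a => let a := mreify R a env in constr:(@MScale R c a)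
  | @GRing.natmul _ ?a ?n => let a := mreify R a env in constr:(@MMuln R a n)
  | _ => let k := mindex e env in constr:(@MVar R k)
  end.

Ltac module_coefs :=
  match goal with
  | |- @eq ?T ?a ?b =>
    let T := eval cbn in T in
    let env := matoms T a (@nil T) in
    let env := matoms T b env in
    match T with
    | GRing.Lmodule.sort ?F =>
      match type of F with
      | GRing.Lmodule.type ?R =>
        let R0 := eval cbn in (GRing.PzRing.sort R) in
        let ea := mreify R0 a env in
        let eb := mreify R0 b env in
        refine (@meval_eq _ F env ea eb _)
      end
    end
  end.


Ltac module :=
  module_coefs; cbn [mcoef_eq mcoef size Nat.eqb];
  repeat split; first [by [] | ring | by field].
(** * Disjointness and localization in Archimedean vector lattices *)

Section VectorLattice.
Variables (R : realType) (F : lmodType R) (le : F -> F -> Prop).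
Hypothesis HV : archimedean_vector_lattice le.

Local Notation "x <~ y" := (le x y) (at level 70).
Local Notation disj a b := (is_glb le (pair_set a b) 0).

Lemma le_refl x : x <~ x.
Proof. by case: HV. Qed.

Lemma le_anti x y : x <~ y -> y <~ x -> x = y.
Proof. by case: HV => _ [h _]; apply: h. Qed.

Lemma le_tr y x z : x <~ y -> y <~ z -> x <~ z.
Proof. by case: HV => _ [_ [h _]]; apply: h. Qed.

Lemma le_subl x y : x <~ y -> 0 <~ y - x.
Proof.
case: HV => _ [_ [_ [h _]]] hxy.
by have := h _ _ (- x) hxy; rewrite subrr.
Qed.

Lemma subl_le x y : 0 <~ y - x -> x <~ y.
Proof.
case: HV => _ [_ [_ [h _]]] hxy.
by have := h _ _ x hxy; rewrite subrK add0r.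
Qed.

Lemma posD x y : 0 <~ x -> 0 <~ y -> 0 <~ x + y.
Proof.
case: HV => _ [_ [_ [h _]]] hx hy.
by apply: le_tr hy _; have := h _ _ y hx; rewrite add0r.
Qed.

Lemma posZ (a : R) x : 0 <= a -> 0 <~ x -> 0 <~ a *: x.
Proof.
case: HV => _ [_ [_ [_ [h _]]]] ha hx.
by have := h a _ _ ha hx; rewrite scaler0.
Qed.

Ltac positive :=
  match goal with
  | |- _ => solve [trivial]
  | |- is_true (0 <= _) => lra
  | |- ?r 0 0 => apply: le_refl
  | |- ?r 0 (_ + - _) => apply: le_subl; solve [trivial]
  | |- ?r 0 (_ + _) => apply: posD; positive
  | |- ?r 0 (_ *: _) => apply: posZ; positive
  end.

(* Proves [x <~ y] from the certificate [y - x = e], [e] being visibly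
   positive. *)
Ltac lin e :=
  apply: subl_le;
  match goal with |- _ 0 ?z => rewrite (_ : z = e); [positive | module] end.

Lemma archimedean_scale x y :
  (forall d : R, 0 < d -> d <= 1 -> x <~ d *: y) -> x <~ 0.
Proof.
move=> h; case: HV => _ [_ [_ [_ [_ [_ [_ arch]]]]]].
(* With [d = 1/(n+1)] the hypothesis gives [(n+1) x <= y], that is [n x <= y - x]. *)
apply: (arch x (y - x)) => n.
have := h n.+1%:R^-1; rewrite invr_gt0 ltr0n invf_le1 ?ltr0n // ler1n.
move=> /(_ isT isT) hn.
have e : 1 + n%:R != 0 :> R by rewrite nat1r pnatr_eq0.
have n0 : 0 <= n.+1%:R :> R by apply: ler0n.
by lin (n.+1%:R *: (n.+1%:R^-1 *: y - x)).
Qed.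

(** * Positive parts and disjoint elements *)

Definition pos_part (x : F) : F :=
  epsilon (inhabits 0) (is_lub le (pair_set x 0)).

Lemma pos_part_lub x : is_lub le (pair_set x 0) (pos_part x).
Proof.
case: HV => _ [_ [_ [_ [_ [_ [h _]]]]]].
exact: (epsilon_spec _ _ (h x 0)).
Qed.

Lemma pos_part_ge x : x <~ pos_part x.
Proof. by case: (pos_part_lub x) => h _; apply: h; left. Qed.

Lemma pos_part_pos x : 0 <~ pos_part x.
Proof. by case: (pos_part_lub x) => h _; apply: h; right. Qed.

Lemma pos_part_le x z : x <~ z -> 0 <~ z -> pos_part x <~ z.
Proof. by move=> hx hz; case: (pos_part_lub x) => _; apply=> ? [] ->. Qed.

Hint Resolve le_refl pos_part_ge pos_part_pos : core.

Lemma pos_part_eq0 x : pos_part x = 0 -> x <~ 0.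
Proof. by move <-. Qed.

Lemma pos_partN x : pos_part (- x) = pos_part x - x.
Proof.
apply: le_anti.
  apply: pos_part_le; first by lin (pos_part x - 0).
  exact: le_subl.
have h1 : x <~ pos_part (- x) + x by lin (pos_part (- x) - 0).
have h2 : 0 <~ pos_part (- x) + x by lin (pos_part (- x) - - x).
have h := pos_part_le h1 h2.
by lin (pos_part (- x) + x - pos_part x).
Qed.

Lemma pos_part_sub x : x = pos_part x - pos_part (- x).
Proof. by rewrite pos_partN; module. Qed.

Lemma disjP a b : 0 <~ a -> 0 <~ b ->
  (forall c, c <~ a -> c <~ b -> c <~ 0) -> disj a b.
Proof.
move=> ha hb h; split=> [z [] -> //|c hc].
by apply: h; apply: hc; [left|right].
Qed.

Lemma disj_le0 a b c : disj a b -> c <~ a -> c <~ b -> c <~ 0.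
Proof. by move=> [_ h] ha hb; apply: h => z [] ->. Qed.

Lemma disj_posl a b : disj a b -> 0 <~ a.
Proof. by case=> h _; apply: h; left. Qed.

Lemma disj_posr a b : disj a b -> 0 <~ b.
Proof. by case=> h _; apply: h; right. Qed.

Lemma disjC a b : disj a b -> disj b a.
Proof.
move=> h; apply: disjP; [exact: disj_posr h|exact: disj_posl h|].
by move=> c hb ha; exact: (disj_le0 h ha hb).
Qed.

Lemma disj_self a c : disj a c -> a <~ c -> a = 0.
Proof. by move=> h ac; apply: le_anti (disj_posl h); apply: disj_le0 h _ ac. Qed.

Lemma disj_le a b c : disj a b -> 0 <~ c -> c <~ b -> disj a c.
Proof.
move=> h c0 cb; apply: disjP => //; first exact: disj_posl h.
by move=> z za zc; apply: disj_le0 h za (le_tr zc cb).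
Qed.

(** If [z] is below [a] and [b + c], then [z - c] is below [a] and [b]; hence [z <= c], and
    disjointness from [c] finishes. *)
Lemma disjD a b c : disj a b -> disj a c -> disj a (b + c).
Proof.
move=> hb hc; have [a0 b0 c0] := And3 (disj_posl hb) (disj_posr hb) (disj_posr hc).
apply: disjP => // [|z za zbc]; first exact: posD.
apply: (disj_le0 hc za).
have h1 : z - c <~ a by lin ((a - z) + c).
have h2 : z - c <~ b by lin ((b + c) - z).
have h := disj_le0 hb h1 h2.
by lin (0 - (z - c)).
Qed.

Lemma disjZ a b (t : R) : 0 <= t -> disj a b -> disj a (t *: b).
Proof.
move=> t0 h; have [a0 b0] := conj (disj_posl h) (disj_posr h).
have [n tn] : exists n : nat, t <= n%:R.
  by exists (Num.bound t); apply: ltW; apply: archi_boundP.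
have hn : disj a (b *+ n).
  elim: n {tn} => [|n IH]; last by rewrite mulrS; apply: disjD.
  by rewrite mulr0n; apply: disjP.
apply: disj_le hn _ _; first exact: posZ.
have tn' : 0 <= n%:R - t by rewrite subr_ge0.
by lin ((n%:R - t) *: b).
Qed.

Lemma disj_pos_part x : disj (pos_part x) (pos_part (- x)).
Proof.
apply: disjP => // c hx hn; rewrite pos_partN in hn.
have h1 : x <~ pos_part x - c by lin (pos_part x - x - c).
have h2 : 0 <~ pos_part x - c by lin (pos_part x - c).
have h := pos_part_le h1 h2.
by lin (pos_part x - c - pos_part x).
Qed.

(* On a suitable nonzero fragment [c] of any [w] not disjoint from [x], the
   quotient [y / x] is constant up to [d].  The slices are cut by the multiples
   [j d x]; if every slice of [w] vanished, [w] would sit where [y >= j d x] for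
   all [j]. *)
Lemma localization (x y w : F) (d : R) :
  0 <~ x -> 0 <~ y -> 0 <~ w -> 0 < d -> d <= 1 ->
  (forall (al : R) g c, 0 <= al -> disj c g -> 0 <~ c -> c <~ w ->
     y <~ (al + d) *: x + g -> al *: x <~ y + d *: x + g -> c = 0) ->
  disj w x.
Proof.
move=> x0 y0 w0 d0 d1 H; apply: disjP => // c1 c1w c1x.
suff p0 : d *: pos_part c1 = 0.
  apply: pos_part_eq0; rewrite -[LHS]scale1r -(@mulVf _ d) ?gt_eqF //.
  by rewrite -scalerA p0 scaler0.
have p1w := pos_part_le c1w w0; have p1x := pos_part_le c1x x0.
have p1pos := pos_part_pos c1.
(* The factor [d] puts [v] below [d x], the distance between consecutive cuts, while keeping it
   below [w]. *)
set v := d *: _; have v0 : 0 <~ v by apply: posZ => //; apply: ltW.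
have vx : v <~ d *: x by rewrite /v; lin (d *: (x - pos_part c1)).
have vw : v <~ w.
  by rewrite /v; lin (d *: (w - pos_part c1) + (1 - d) *: w).
clearbody v; clear p1w p1x p1pos c1w c1x c1.
(* The slice where [(j-1) d x <= y <= (j+1) d x]: there [H] applies with [al = j d], and [g]
   collects the two excesses disjoint from [c^+]. *)
have slice (j : nat) :
    forall c, c <~ v -> c <~ pos_part (y - (j%:R * d - d) *: x) ->
    c <~ pos_part (- (y - (j%:R * d + d) *: x)) -> c <~ 0.
  move=> c cv c1 c2; apply: pos_part_eq0.
  set t1 := y - _ in c1; set t2 := y - _ in c2.
  have h1 : disj (pos_part c) (pos_part (- t1)).
    apply: disjC; apply: disj_le (pos_part_pos _) (pos_part_le c1 (pos_part_pos _)).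
    exact/disjC/disj_pos_part.
  have h2 : disj (pos_part c) (pos_part t2).
    apply: disjC; apply: disj_le (pos_part_pos _) (pos_part_le c2 (pos_part_pos _)).
    exact: disj_pos_part.
  have [g1 g2] := (pos_part_ge (- t1), pos_part_ge t2).
  have [e1 e2] := (pos_part_pos (- t1), pos_part_pos t2).
  move: (pos_part (- t1)) (pos_part t2) h1 h2 g1 g2 e1 e2 => p1 p2 h1 h2 g1 g2 e1 e2.
  rewrite /t1 in g1; rewrite /t2 in g2.
  apply: (H (j%:R * d) (p1 + p2)).
  - by rewrite mulr_ge0 // ltW.
  - exact: disjD.
  - by [].
  - by apply: pos_part_le => //; apply: le_tr vw.
  - by lin (p1 + (p2 - (y - (j%:R * d + d) *: x))).
  - by lin (p2 + (p1 - - (y - (j%:R * d - d) *: x))).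
have vd j : disj v (pos_part (- (y - (j%:R * d) *: x))).
  elim: j => [|j IH].
    rewrite mul0r scale0r subr0 (_ : pos_part _ = 0); first exact: disjP.
    by apply: le_anti => //; apply: pos_part_le => //; lin y.
  apply: disjP => // c cv ct; apply: (disj_le0 IH cv).
  set n := pos_part _ in ct *; set p := pos_part (- (y - (j%:R * d) *: x)).
  have p0 : 0 <~ p by apply: pos_part_pos.
  (* Since [c <= v <= d x], subtracting [p = (j d x - y)^+] moves [c] into slice [j]; thus [c <= p],
     and the induction hypothesis applies. *)
  have q : c - p <~ 0.
    apply: (slice j).
    - by lin ((v - c) + p).
    - have h1 := pos_part_ge (y - (j%:R * d - d) *: x).
      have h2 := pos_part_ge (- (y - (j%:R * d) *: x)).
      set q := pos_part _ in h1 *; rewrite -/p in h2.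
      lin ((q - (y - (j%:R * d - d) *: x)) + (d *: x - v) + (v - c)
           + (p - - (y - (j%:R * d) *: x))).
    - rewrite (_ : j%:R * d + d = j.+1%:R * d); last by rewrite -natr1; ring.
      by rewrite -/n; lin ((n - c) + p).
  by lin (0 - (c - p)).
(* The element [j v - y] lies below both [j v] and [(j d x - y)^+], which are disjoint. *)
have dv (j : nat) : v *+ j <~ y.
  have h : disj (v *+ j) (pos_part (- (y - (j%:R * d) *: x))).
    apply: disjC; rewrite -scaler_nat; apply: disjZ; first exact: ler0n.
    exact: disjC.
  have hp := pos_part_ge (- (y - (j%:R * d) *: x)).
  set p := pos_part _ in h hp.
  have vj : v *+ j <~ (j%:R * d) *: x.
    have j0 : 0 <= j%:R :> R by apply: ler0n.
    by lin (j%:R *: (d *: x - v)).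
  have q : v *+ j - y <~ 0.
    apply: (disj_le0 h); first by lin y.
    by lin ((p - - (y - (j%:R * d) *: x)) + ((j%:R * d) *: x - v *+ j)).
  by lin (0 - (v *+ j - y)).
case: HV => _ [_ [_ [_ [_ [_ [_ arch]]]]]].
by apply: le_anti (arch _ _ dv) _.
Qed.


(** * Positive orthomorphisms commute *)

Definition pos_orth (f : F -> F) : Prop :=
  [/\ forall (a : R) x y, f (a *: x + y) = a *: f x + f y,
      forall x, 0 <~ x -> 0 <~ f x &
      forall x y, disj x y -> disj (f x) y].

Lemma pos_orth_mono f x y : pos_orth f -> x <~ y -> f x <~ f y.
Proof.
case=> lf pf _ /le_subl/pf.
by rewrite addrC -scaleN1r lf scaleN1r addrC => /subl_le.
Qed.

Lemma pos_orthD f x y : pos_orth f -> f (x + y) = f x + f y.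
Proof. by case=> lf _ _; rewrite -[x]scale1r lf !scale1r. Qed.

Lemma pos_orthZ f (a : R) x : pos_orth f -> f (a *: x) = a *: f x.
Proof.
case=> lf _ _; have f0 : f 0 = 0.
  by have := lf 1 0 0; rewrite !scale1r addr0 -{1}[f 0]addr0 => /addrI.
by rewrite -[a *: x]addr0 lf f0 addr0.
Qed.

(* Where [g x ~ al x] and [f x ~ be x] up to [d], both compositions are
   [al be x] up to [2 d (f x + g x + x)]. *)
Lemma pos_orth_comm_le f g x :
  pos_orth f -> pos_orth g -> 0 <~ x -> f (g x) <~ g (f x).
Proof.
move=> hf hg x0; have [[_ pf df] [_ pg dg]] := (hf, hg).
have [fx0 gx0] := (pf _ x0, pg _ x0); have [fgx0 gfx0] := (pf _ gx0, pg _ fx0).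
suff h : f (g x) - g (f x) <~ 0 by lin (0 - (f (g x) - g (f x))).
apply: (archimedean_scale (y := 2 *: (f x + g x + x))) => d d0 d1.
set D := f (g x) - g (f x); set E := d *: _.
suff h : pos_part (D - E) = 0.
  by have h0 := pos_part_eq0 h; lin (0 - (D - E)).
have wf : pos_part (D - E) <~ f (g x).
  apply: pos_part_le => //; rewrite /D /E.
  by lin (g (f x) + (d * 2) *: (f x + g x + x)).
set w := pos_part _ in wf *; have w0 : 0 <~ w by apply: pos_part_pos.
(* What is disjoint from [x] is disjoint from [f (g x)], which dominates [w]. *)
have kill c : 0 <~ c -> c <~ w -> disj c x -> c = 0.
  move=> c0 cw cx; apply: (@disj_self c (f (g x))); last exact: le_tr cw wf.
  exact/disjC/df/dg/disjC.
(* Two nested localizations: [g x] is close to [al x] on [c], then [f x] is close to [be x] on [c'].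
   All terms in [h] and [k] are disjoint from [c']. *)
apply: (kill _) => //; apply: (@localization x (g x) w d) => //.
move=> al h c al0 ch c0 cw u1 u2; apply: (kill _) => //.
apply: (@localization x (f x) c d) => // be k c' be0 ck c'0 cc v1 v2.
have ch' : disj c' h by apply: disjC; apply: disj_le c'0 cc; apply: disjC.
have [h0 k0] := (disj_posr ch', disj_posr ck).
have [fh0 gk0] := (pf _ h0, pg _ k0).
have cfh : disj c' (f h) by exact/disjC/df/disjC.
have cgk : disj c' (g k) by exact/disjC/dg/disjC.
have d0' := ltW d0.
apply: (@disj_self c' (f h + g k + (al + d) *: k + (be + d) *: h)).
  apply: disjD; last by apply: disjZ => //; lra.
  by apply: disjD; [apply: disjD|apply: disjZ => //; lra].
apply: (le_tr cc); apply: (le_tr cw); apply: pos_part_le; last first.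
  by lin (f h + g k + (al + d) *: k + (be + d) *: h).
have := pos_orth_mono hf u1; rewrite (pos_orthD _ _ hf) (pos_orthZ _ _ hf) => m1.
have := pos_orth_mono hg v2; rewrite !(pos_orthD _ _ hg) !(pos_orthZ _ _ hg) => m2.
(* The errors [d al x] and [d be x] are bounded again through [g x] and [f x]; this leaves
   [2 d^2 x], absorbed by [2 d x] as [d <= 1]. *)
have dd : 0 <= d - d * d by rewrite -[X in X - _]mulr1 -mulrBr mulr_ge0 ?subr_ge0.
rewrite /D /E.
by lin ((((al + d) *: f x + f h) - f (g x)) + ((g (f x) + d *: g x + g k) - be *: g x)
  + al *: (((be + d) *: x + k) - f x) + be *: ((g x + d *: x + h) - al *: x)
  + d *: ((g x + d *: x + h) - al *: x) + d *: ((f x + d *: x + k) - be *: x)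
  + (2 * (d - d * d)) *: x).
Qed.

Lemma pos_orth_comm f g x :
  pos_orth f -> pos_orth g -> 0 <~ x -> f (g x) = g (f x).
Proof.
move=> hf hg x0.
exact: le_anti (pos_orth_comm_le hf hg x0) (pos_orth_comm_le hg hf x0).
Qed.

(** * Semiprime f-algebras *)

Variable mul : F -> F -> F.
Local Notation "x ** y" := (mul x y) (at level 40, left associativity).

(** The clauses of [f_algebra] after the lattice one, verbatim, so that an f-algebra splits into the
    two hypotheses [HV] and [HM]. *)
Definition f_multiplication : Prop :=
  (forall (a : R) x y z, mul (a *: x + y) z = a *: mul x z + mul y z) /\
  (forall (a : R) x y z, mul x (a *: y + z) = a *: mul x y + mul x z) /\
  (forall x y z, mul x (mul y z) = mul (mul x y) z) /\
  (forall x y, le 0 x -> le 0 y -> le 0 (mul x y)) /\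
  (forall x y z, is_glb le (pair_set x y) 0 -> le 0 z ->
     is_glb le (pair_set (mul x z) y) 0 /\ is_glb le (pair_set x (mul y z)) 0).

Hypothesis HM : f_multiplication.

Lemma mulfDl x y z : (x + y) ** z = x ** z + y ** z.
Proof. by case: HM => h _; rewrite -[x]scale1r h !scale1r. Qed.

Lemma mulfDr x y z : x ** (y + z) = x ** y + x ** z.
Proof. by case: HM => _ [h _]; rewrite -[y]scale1r h !scale1r. Qed.

Lemma mulf0 x : x ** 0 = 0.
Proof. by apply: (@addrI _ (x ** 0)); rewrite -mulfDr !addr0. Qed.

Lemma mul0f x : 0 ** x = 0.
Proof. by apply: (@addrI _ (0 ** x)); rewrite -mulfDl !addr0. Qed.

Lemma mulfZl (a : R) x y : (a *: x) ** y = a *: (x ** y).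
Proof. by case: HM => h _; rewrite -[a *: x]addr0 h mul0f addr0. Qed.

Lemma mulfZr (a : R) x y : x ** (a *: y) = a *: (x ** y).
Proof. by case: HM => _ [h _]; rewrite -[a *: y]addr0 h mulf0 addr0. Qed.

Lemma mulfNl x y : (- x) ** y = - (x ** y).
Proof. by rewrite -scaleN1r mulfZl scaleN1r. Qed.

Lemma mulfNr x y : x ** (- y) = - (x ** y).
Proof. by rewrite -scaleN1r mulfZr scaleN1r. Qed.

Definition mulfE := (mulfDl, mulfDr, mulfNl, mulfNr, mulfZl, mulfZr, mulf0, mul0f).

Lemma mulfA x y z : x ** (y ** z) = x ** y ** z.
Proof. by case: HM => _ [_ [h _]]. Qed.

Lemma mulf_pos x y : 0 <~ x -> 0 <~ y -> 0 <~ x ** y.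
Proof. by case: HM => _ [_ [_ [h _]]]; apply: h. Qed.

Lemma mulf_disj x y z : disj x y -> 0 <~ z -> disj (x ** z) y.
Proof. by case: HM => _ [_ [_ [_ h]]] hd hz; case: (h _ _ _ hd hz). Qed.

Lemma mulf_pos_orth z : 0 <~ z -> pos_orth (mul^~ z).
Proof.
move=> z0; split=> [a x y|x x0|x y hd]; first by rewrite mulfDl mulfZl.
- exact: mulf_pos.
- exact: mulf_disj.
Qed.

Hypothesis Hsp : semiprime mul.

Lemma sqrf_eq0 x : x ** x = 0 -> x = 0.
Proof. by move=> h; apply: Hsp; exists 1. Qed.

(* The axioms only make right multiplications orthomorphisms, so their
   commutation yields [x (w z) = x (z w)]; hence [w z - z w] squares to zero. *)
Lemma mulfC x y : x ** y = y ** x.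
Proof.
have hpos w z : 0 <~ w -> 0 <~ z -> w ** z = z ** w.
  move=> w0 z0.
  have h t : t ** (w ** z - z ** w) = 0.
    have hp s : 0 <~ s -> s ** (w ** z - z ** w) = 0.
      move=> s0; rewrite mulfDr mulfNr !mulfA.
      have /= -> := pos_orth_comm (mulf_pos_orth z0) (mulf_pos_orth w0) s0.
      exact: subrr.
    by rewrite [t]pos_part_sub mulfDl mulfNl !hp ?subr0.
  by apply/eqP; rewrite -subr_eq0; apply/eqP/sqrf_eq0/h.
rewrite [x]pos_part_sub [y]pos_part_sub !mulfE.
have h a b : pos_part a ** pos_part b = pos_part b ** pos_part a by apply: hpos.
by rewrite (h y x) (h y (- x)) (h (- y) x) (h (- y) (- x)); module.
Qed.

(** Multiplying each side in turn makes [q p] disjoint from [p q]; by commutativity the product is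
    disjoint from itself. *)
Lemma disj_mulf p q : disj p q -> p ** q = 0.
Proof.
move=> h; have [p0 q0] := (disj_posl h, disj_posr h).
have h1 : disj (q ** p) (p ** q) by apply: mulf_disj => //; apply/disjC/mulf_disj.
by apply: (disj_self (c := p ** q)); [rewrite {1}mulfC|].
Qed.

(** The cross terms in the square of [x^+ - x^-] vanish by disjointness. *)
Lemma sqrf_pos x : 0 <~ x ** x.
Proof.
have h := disj_mulf (disj_pos_part x).
rewrite [x]pos_part_sub !mulfE (mulfC (pos_part (- x)) (pos_part x)) h.
have h1 := mulf_pos (pos_part_pos x) (pos_part_pos x).
have h2 := mulf_pos (pos_part_pos (- x)) (pos_part_pos (- x)).
by apply: eq_ind (posD h1 h2) _ _; module.
Qed.

(** For [p = (m - n)^+] one has [p (m - n) = p^2], so [p (n^2 - m^2) >= 0] reads [p^2 (m + n) <= 0].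
    As [p <= m], this forces [p^3 = 0]. *)
Lemma sqrf_le m n : 0 <~ m -> 0 <~ n -> m ** m <~ n ** n -> m <~ n.
Proof.
move=> m0 n0 h; set p := pos_part (m - n).
suff p0 : p = 0 by have h0 := pos_part_eq0 p0; lin (0 - (m - n)).
have p0 : 0 <~ p by apply: pos_part_pos.
have pm : p <~ m by apply: pos_part_le => //; lin n.
have ep : p ** (m - n) = p ** p.
  rewrite [in LHS](pos_part_sub (m - n)) mulfDr mulfNr.
  by rewrite (disj_mulf (disj_pos_part _)) subr0.
apply: Hsp; exists 2; rewrite /= mulfA; apply: le_anti; last first.
  by apply: mulf_pos => //; apply: mulf_pos.
have h1 := mulf_pos p0 (le_subl h).
have h2 := mulf_pos (mulf_pos p0 p0) (le_subl pm).
have h3 := mulf_pos (mulf_pos p0 p0) n0.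
have e : p ** (n ** n - m ** m) = - (p ** p ** (m + n)).
  rewrite -ep -mulfA; rewrite !mulfE (mulfC n m); module.
rewrite e in h1; rewrite !mulfE in h1 h2.
by lin (- (p ** p ** m + p ** p ** n) + (p ** p ** m + - (p ** p ** p)) + p ** p ** n).
Qed.

Lemma sqrf_inj m n : 0 <~ m -> 0 <~ n -> m ** m = n ** n -> m = n.
Proof.
by move=> m0 n0 h; apply: le_anti; apply: sqrf_le => //; rewrite h.
Qed.

(* The weight [t] is taken within [e] of the local value of [d / c], which
   makes [t^-1 (t c - d)^2] at most [4 e c^2] there. *)
Lemma weighted_mean_le c d m : 0 <~ c -> 0 <~ d -> 0 <~ m ->
  (forall t : R, 0 < t -> m <~ t *: (c ** c) + t^-1 *: (d ** d)) ->
  m <~ 2 *: (c ** d).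
Proof.
move=> c0 d0 m0 H.
have [cc cd dd] := And3 (mulf_pos c0 c0) (mulf_pos c0 d0) (mulf_pos d0 d0).
suff h : m - 2 *: (c ** d) <~ 0 by lin (0 - (m - 2 *: (c ** d))).
apply: (archimedean_scale (y := 4 *: (c ** c))) => e e0 e1.
have e0' := ltW e0.
set w := pos_part (m - 2 *: (c ** d) - (e * 4) *: (c ** c)).
suff w0 : w = 0.
  have h := pos_part_eq0 w0.
  by lin (0 - (m - 2 *: (c ** d) - (e * 4) *: (c ** c))).
have w0 : 0 <~ w by apply: pos_part_pos.
have wm : w <~ m.
  by apply: pos_part_le => //; lin (2 *: (c ** d) + (e * 4) *: (c ** c)).
(* Away from [c] the term in [c^2] drops out of the bound, and the weight of [d^2] can be made
   arbitrarily small. *)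
have wc : disj w c -> w = 0.
  move=> hc; have hcc : disj w (c ** c) by apply/disjC/mulf_disj => //; apply/disjC.
  apply: le_anti w0; apply: (archimedean_scale (y := d ** d)) => t t0 t1.
  have ht : 0 < t^-1 by rewrite invr_gt0.
  have hm := H _ ht; rewrite invrK in hm.
  have hw : w - t *: (d ** d) <~ 0.
    apply: (disj_le0 (disjZ (ltW ht) hcc)).
      by have t0' := ltW t0; lin (t *: (d ** d)).
    by lin ((m - w) + (t^-1 *: (c ** c) + t *: (d ** d) - m)).
  by lin (0 - (w - t *: (d ** d))).
apply: wc; apply: (@localization c d w e) => // al g v al0 vg v0 vw u1 u2.
have g0 := disj_posr vg; have cg := mulf_pos c0 g0; have gg := mulf_pos g0 g0.
(* The weight is [al + e], since [al] itself may be 0. *)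
have t0 : 0 < al + e by lra.
have tn : al + e != 0 by rewrite gt_eqF.
have ti : 0 <= (al + e)^-1 by rewrite invr_ge0 ltW.
apply: (@disj_self v ((al + e)^-1 *: ((4 * e) *: (c ** g) + g ** g))).
  apply: disjZ => //; apply: disjD; last by apply/disjC/mulf_disj => //; apply/disjC.
  apply: disjZ; first lra.
  by rewrite mulfC; apply/disjC/mulf_disj => //; apply/disjC.
apply: (le_tr vw); apply: pos_part_le; last first.
  by apply: posZ => //; apply: posD => //; apply: posZ => //; lra.
have hm := H _ t0.
(* Together [z1] and [z2] say [|t c - d| <= 2 e c + g] for [t = al + e]; their product compares the
   squares. *)
have z1 : 0 <~ (2 * e) *: c + g - ((al + e) *: c - d).
  by apply: le_subl; lin ((d + e *: c + g) - al *: c).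
have z2 : 0 <~ (2 * e) *: c + g + ((al + e) *: c - d).
  by rewrite -[X in _ + X]opprK; apply: le_subl; lin (((al + e) *: c + g - d) + (2 * e) *: c).
have hz : 0 <~ (4 * e * e) *: (c ** c) + (4 * e) *: (c ** g) + g ** g
    - (((al + e) * (al + e)) *: (c ** c) - (2 * (al + e)) *: (c ** d) + d ** d).
  have := mulf_pos z1 z2; rewrite !mulfE (mulfC d c) (mulfC g c) (mulfC d g) => h.
  by apply: eq_ind h _ _; module.
(* This is the nonnegative gap between [4 e] and [4 e^2 / (al + e)]. *)
have ee : 0 <= 4 * e * al / (al + e) by rewrite !mulr_ge0.
by lin (((al + e) *: (c ** c) + (al + e)^-1 *: (d ** d) - m)
  + (al + e)^-1 *: ((4 * e * e) *: (c ** c) + (4 * e) *: (c ** g) + g ** g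
    - (((al + e) * (al + e)) *: (c ** c) - (2 * (al + e)) *: (c ** d) + d ** d))
  + (4 * e * al / (al + e)) *: (c ** c)).
Qed.

(** * Infima of weighted means, [boxtimes] and square roots *)

Lemma glbF_eq S a : is_glb le S a -> glbF le S = a.
Proof.
move=> ha; have [h1 h2] : is_glb le S (glbF le S).
  by apply: (epsilon_spec (inhabits 0) (is_glb le S)); exists a.
by case: ha => h3 h4; apply: le_anti; [apply: h4|apply: h2].
Qed.

Lemma glb_weighted_mean c d : 0 <~ c -> 0 <~ d ->
  is_glb le (fun z => exists t : R, 0 < t /\ z = t *: (c ** c) + t^-1 *: (d ** d))
    (2 *: (c ** d)).
Proof.
move=> c0 d0; split=> [z [t [t0 ->]]|b hb].
  have t1 : t != 0 by rewrite gt_eqF.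
  have h : 0 <~ t *: (t *: (c ** c)) - (2 * t) *: (c ** d) + d ** d.
    have := sqrf_pos (t *: c - d); rewrite !mulfE (mulfC d c) => h.
    by apply: eq_ind h _ _; module.
  have ti : 0 <= t^-1 by rewrite invr_ge0 ltW.
  by lin (t^-1 *: (t *: (t *: (c ** c)) - (2 * t) *: (c ** d) + d ** d)).
(* The bound is proved for positive lower bounds; [b^+] is still one because the family is
   positive. *)
apply: (le_tr (pos_part_ge b)); apply: weighted_mean_le => // t t0.
apply: pos_part_le; first by apply: hb; exists t.
have t1 := ltW t0; have t2 : 0 <= t^-1 by rewrite invr_ge0.
by apply: posD; apply: posZ => //; apply: mulf_pos.
Qed.

Hypothesis Hsq : sqrt_closed le mul.

(** Writing [a = c^2] and [v = d^2], the infimum is [2 c d], so [boxtimes] equals [c d]. *)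
Lemma boxtimesP a v : 0 <~ a -> 0 <~ v ->
  0 <~ boxtimes le a v /\ boxtimes le a v ** boxtimes le a v = a ** v.
Proof.
move=> /Hsq [c [c0 <-]] /Hsq [d [d0 <-]].
rewrite /boxtimes (glbF_eq (glb_weighted_mean c0 d0)) scalerA mulVf ?pnatr_eq0 //.
rewrite scale1r; split; first exact: mulf_pos.
by rewrite !mulfA -[c ** d ** c]mulfA (mulfC d c) mulfA.
Qed.

Lemma sqrtFP a : 0 <~ a -> 0 <~ sqrtF le mul a /\ sqrtF le mul a ** sqrtF le mul a = a.
Proof. by move=> /Hsq h; apply: (epsilon_spec (inhabits 0) _ h). Qed.

(** * The squared seminorm as a quadratic form *)

Section SemiInnerProduct.
Variables (V : lmodType R) (T : V -> V -> F) (u : F).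
Hypotheses (HT : vector_semi_inner_product le T) (hu : 0 <~ u).

Local Notation N := (normTu le T u).

Lemma normTu_pos x : 0 <~ N x.
Proof. by case: HT => _ _ h; case: (boxtimesP (h x) hu). Qed.

Lemma sqr_normTu x : N x ** N x = T x x ** u.
Proof. by case: HT => _ _ h; case: (boxtimesP (h x) hu). Qed.

Lemma semi_inner_sqr (a b : R) x y :
  T (a *: x + b *: y) (a *: x + b *: y) =
  (a * a) *: T x x + (2 * a * b) *: T x y + (b * b) *: T y y.
Proof.
case: HT => lT sT _.
have T0 z : T 0 z = 0.
  by have := lT 1 0 0 z; rewrite !scale1r addr0 -{1}[T 0 z]addr0 => /addrI.
have TZ c z t : T (c *: z) t = c *: T z t by rewrite -[c *: z]addr0 lT T0 addr0.
have TZr c z t : T t (c *: z) = c *: T t z by rewrite sT TZ sT.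
have TD z z' t : T (z + z') t = T z t + T z' t by rewrite -[z]scale1r lT !scale1r.
have TDr z z' t : T t (z + z') = T t z + T t z' by rewrite sT TD !(sT t).
by rewrite TD !TDr !TZ !TZr (sT y x); module.
Qed.

Lemma sqr_normTuD (a b : R) x y :
  N (a *: x + b *: y) ** N (a *: x + b *: y) =
  (a * a) *: (N x ** N x) + (2 * a * b) *: (T x y ** u) + (b * b) *: (N y ** N y).
Proof. by rewrite !sqr_normTu semi_inner_sqr !mulfE. Qed.

(* The sign of [lam] contributes [- 2 (T(x,y) u)] or [2 (T(x,y) u)], its modulus
   the weighted mean of [N x ^ 2] and [N y ^ 2]. *)
Lemma glb_scaled_sqr_normTuB x y :
  is_glb le (fun z => exists lam : R, lam != 0 /\
               z = `|lam|^-1 *: (N (lam *: x - y) ** N (lam *: x - y)))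
    (2 *: (N x ** N y) - 2 *: (pos_part (T x y ** u) + pos_part (- (T x y ** u)))).
Proof.
have [h1 h2] := glb_weighted_mean (normTu_pos x) (normTu_pos y).
have E (lam : R) : lam != 0 ->
    `|lam|^-1 *: (N (lam *: x - y) ** N (lam *: x - y)) =
    `|lam| *: (N x ** N x) + `|lam|^-1 *: (N y ** N y)
    - (2 * Num.sg lam) *: (T x y ** u).
  move=> l0; rewrite -scaleN1r sqr_normTuD [in LHS](numEsg lam).
  have n0 : `|lam| != 0 by rewrite normr_eq0.
  have s1 : Num.sg lam * Num.sg lam = 1 by rewrite -expr2 sqr_sg l0.
  rewrite normrM normr_id normr_sg l0 mul1r.
  rewrite (_ : Num.sg lam * `|lam| * (Num.sg lam * `|lam|) =
               Num.sg lam * Num.sg lam * (`|lam| * `|lam|)); last by ring.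
  by rewrite s1; module.
set C := T x y ** u in E *; set M := N x ** N y in h1 h2 *.
have [p0 n0] := (pos_part_pos C, pos_part_pos (- C)).
have [pC nC] := (pos_part_ge C, pos_part_ge (- C)).
split=> [z [lam [l0 ->]]|b hb].
  rewrite E //; have l1 : 0 < `|lam| by rewrite normr_gt0.
  have hl : 2 *: M <~ `|lam| *: (N x ** N x) + `|lam|^-1 *: (N y ** N y).
    by apply: h1; exists `|lam|.
  set X := `|lam| *: _ + `|lam|^-1 *: _ in hl *.
  have [l2|l2] : Num.sg lam = 1 \/ Num.sg lam = -1.
    by case: (ltgtP lam 0) l0 => // [/ltr0_sg ->|/gtr0_sg ->]; [right|left].
  - by rewrite l2; lin ((X - 2 *: M) + 2 *: (pos_part C - C) + 2 *: pos_part (- C)).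
  - by rewrite l2; lin ((X - 2 *: M) + 2 *: (pos_part (- C) - - C) + 2 *: pos_part C).
have b1 : b + 2 *: C <~ 2 *: M.
  apply: h2 => z [t [t0 ->]]; have tn : t != 0 by rewrite gt_eqF.
  have := hb _ (ex_intro _ t (conj tn erefl)); rewrite E // gtr0_sg // gtr0_norm //.
  set X := t *: _ + t^-1 *: _ => h.
  by lin (X - (2 * 1) *: C - b).
have b2 : b - 2 *: C <~ 2 *: M.
  apply: h2 => z [t [t0 ->]]; have tn : - t != 0 by rewrite oppr_eq0 gt_eqF.
  have := hb _ (ex_intro _ (- t) (conj tn erefl)).
  rewrite E // sgrN normrN gtr0_sg // gtr0_norm //.
  set X := t *: _ + t^-1 *: _ => h.
  by lin (X - (2 * - 1) *: C - b).
(* This is [b <= 2 M - 2 |C|] solved for [C^+], using [|C| = 2 C^+ - C]; that the right side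
   dominates [C] and 0 is exactly [b1] and [b2]. *)
have h : pos_part C <~ 2^-1 *: C + 4^-1 *: (2 *: M - b).
  apply: pos_part_le; first by lin (4^-1 *: (2 *: M - (b + 2 *: C))).
  by lin (4^-1 *: (2 *: M - (b - 2 *: C))).
rewrite pos_partN.
by lin (4 *: (2^-1 *: C + 4^-1 *: (2 *: M - b) - pos_part C)).
Qed.

End SemiInnerProduct.

End VectorLattice.

(** * Comparison of the radicand with both squares, and the equality case *)

Theorem theorem3p4 (R : realType) (V F : lmodType R)
  (le : F -> F -> Prop) (mul : F -> F -> F)
  (HF : f_algebra le mul) (Hsp : semiprime mul) (Hsq : sqrt_closed le mul)
  (T : V -> V -> F) (HT : vector_semi_inner_product le T)
  (u : F) (hu : le 0 u) (x y : V) :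
  let N := normTu le T u in
  let S := fun z : F => exists lam : R, lam != 0 /\
             z = `|lam|^-1 *: mul (N (lam *: x - y)) (N (lam *: x - y)) in
  let I := glbF le S in
  let s := sqrtF le mul (mul (N x + N y) (N x + N y) - I) in
  [/\ is_glb le S I,
      le 0 (mul (N x + N y) (N x + N y) - I),
      le (N (x + y)) s,
      le s (N x + N y) &
      (N (x + y) = s <-> le 0 (mul (T x y) u))].
Proof.
move=> N S I s; have [HV HM] := HF.
have hS := glb_scaled_sqr_normTuB HV HM Hsp Hsq HT hu x y.
have eI : I = _ := glbF_eq HV hS.
rewrite -/S -/N -eI in hS.
have NP z : le 0 (N z) := normTu_pos HV HM Hsp Hsq HT hu z.
(* Positivity of the infimum yields the second inequality. *)
have I0 : le 0 I.
  case: hS => _; apply=> z [lam [_ ->]]; apply: (posZ HV).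
    by rewrite invr_ge0.
  exact: (sqrf_pos HV HM Hsp).
set C := mul (T x y) u in eI *.
have [p0 n0] := (pos_part_pos HV C, pos_part_pos HV (- C)).
have sNN : mul (N x + N y) (N x + N y) =
    mul (N x) (N x) + 2 *: mul (N x) (N y) + mul (N y) (N y).
  rewrite !(mulfDl HM) !(mulfDr HM) (mulfC HV HM Hsp (N y) (N x)); module.
have eN : mul (N (x + y)) (N (x + y)) =
    mul (N x) (N x) + 2 *: C + mul (N y) (N y).
  have := sqr_normTuD HV HM Hsp Hsq HT hu 1 1 x y.
  by rewrite -/N -/C !scale1r !mulr1 !scale1r.
(* The excess of the radicand is [2 |C| - 2 C = 4 C^-]: it is positive, and it vanishes exactly when
   [C >= 0]. *)
have eD : mul (N x + N y) (N x + N y) - I =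
    mul (N (x + y)) (N (x + y)) + 4 *: pos_part le (- C).
  rewrite sNN eN eI.
  have := pos_part_sub HV C.
  move: (pos_part le (- C)) (pos_part le C) => n p ->; module.
have D0 : le 0 (mul (N x + N y) (N x + N y) - I).
  rewrite eD; apply: (posD HV); first exact: (sqrf_pos HV HM Hsp).
  exact: (posZ HV).
have [s0 ss] := sqrtFP Hsq D0; rewrite -/s in s0 ss.
split=> //.
- apply: (sqrf_le HV HM Hsp) => //; rewrite ss eD.
  by apply: (subl_le HV); rewrite addrC addKr; apply: (posZ HV).
- apply: (sqrf_le HV HM Hsp) => //; first exact: (posD HV).
  by rewrite ss; apply: (subl_le HV); rewrite opprB addrC subrK.
split=> [e|hC].
  have n1 : pos_part le (- C) = 0.
    move: eD; rewrite -ss -e -[LHS]addr0 => /addrI /esym/eqP.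
    by rewrite scaler_eq0 pnatr_eq0 => /eqP.
  by rewrite (pos_part_sub HV C) n1 subr0.
apply: (sqrf_inj HV HM Hsp) => //; rewrite ss eD.
rewrite (_ : pos_part le (- C) = 0) ?scaler0 ?addr0 //.
apply: (le_anti HV) => //; apply: (pos_part_le HV); last exact: (le_refl HV).
by apply: (subl_le HV); rewrite sub0r opprK.
Qed.
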